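(* Let $X\subset \mathbb{R}^d$ and $Y\subset \mathbb{R}^k$ be convex and compact sets with nonempty interiors. Let $f:X\times Y\to\mathbb{R}$ be continuous, and assume that $x\mapsto f(x,y)$ is concave on $X$ for all $y\in Y$ and that $y\mapsto f(x,y)$ is convex on $Y$ for all $x\in X$. Then $f$ has a saddle point $(x^*,y^* )\in X\times Y$.
   Context: For $f:X\times Y\to\mathbb{R}$, a pair $(x^*,y^* )\in X\times Y$ is called a saddle point of $f$ if $f(x,y^* )\le f(x^*,y^* )\le f(x^*,y)$ for all $(x,y)\in X\times Y$. *)

(* Defs.v *)
From HB Require Import structures.
From mathcomp Require Import all_boot all_order all_algebra.
From mathcomp Require Import interval_inference.
From mathcomp Require Import all_classical all_reals all_analysis.
Import Order.TTheory GRing.Theory Num.Theory.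
Import numFieldNormedType.Exports.

Set Implicit Arguments.
Unset Strict Implicit.
Unset Printing Implicit Defensive.

Local Open Scope classical_set_scope.
Local Open Scope ring_scope.
Local Open Scope convex_scope.

(* The analogue of the library's [convex_function], with the inequality
   reversed. *)
Definition concave_function (R : numFieldType) (E : lmodType R)
    (E' := convex_lmodType E) (D : set E') (f : E' -> R^o) :=
  forall (t : {i01 R}),
    {in D &, forall (x y : E'), (f x <| t |> f y <= f (x <| t |> y))%R}.

(* A function X x Y -> R is encoded as a total function on the ambient product,
   of which only the values on X `*` Y are constrained. *)
Definition saddle_point (R : realType) (T U : Type) (X : set T) (Y : set U)
    (f : T * U -> R) (p : T * U) :=
  p \in X `*` Y /\
  forall x y, x \in X -> y \in Y ->
    f (x, p.2) <= f p /\ f p <= f (p.1, y).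

(* Main.v *)
(* Two convex functions that are never simultaneously negative on a convex set
   have a convex combination that is nonnegative on it: every point where one
   of them is negative bounds the admissible weights from one side, and
   convexity makes the lower bounds compatible with the upper ones. Since f is
   concave in x, finitely many functions f(x_i, .) can be merged into one
   f(x, .) by induction on their number, restricting each time to the convex
   subset where one of them is small. With v = sup_x min_y f(x, y), compactness
   of Y then yields ys with f(x, ys) <= v for all x; the same argument applied
   to -f with the variables exchanged yields xs with v <= f(xs, y) for all y. *)

Require Import Defs.
From HB Require Import structures.
From mathcomp Require Import all_boot all_order all_algebra.
From mathcomp Require Import interval_inference.
From mathcomp Require Import all_classical all_reals all_analysis.
From mathcomp Require Import ring lra.
Import Order.TTheory GRing.Theory Num.Theory.
Import numFieldNormedType.Exports.
Local Open Scope classical_set_scope.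
Local Open Scope ring_scope.
Local Open Scope convex_scope.

Lemma convR_subE (R : numDomainType) (a b : R^o) (t : {i01 R}) :
  a <| t |> b = t%:num * a + (1 - t%:num) * b.
Proof. by []. Qed.

(** Along the segment from [z] to [y], convexity bounds [g] and [h] by their chords. The chord of
    [g] is negative near [y], that of [h] near [z]; the last hypothesis says that these two ranges
    of weights overlap. *)
Lemma convex_lt0_segment (R : realType) (E : lmodType R)
    (D : set (convex_lmodType E)) (g h : E -> R)
    (y z : convex_lmodType E) :
  convex_set D -> convex_function D g -> convex_function D h ->
  y \in D -> z \in D -> g y < 0 -> h z < 0 -> 0 <= h y -> 0 <= g z ->
  g z * h y < g y * h z ->
  exists2 w, w \in D & g w < 0 /\ h w < 0.
Proof.
move=> cD cg ch yD zD gy hz hy gz lt.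
(* With weights proportional to [a] and [b], both combinations of the values
   at [y] and [z] equal [(g z * h y - g y * h z) / (a + b)]. *)
pose a := g z - h z; pose b := h y - g y.
have a0 : 0 < a by rewrite /a; lra.
have b0 : 0 < b by rewrite /b; lra.
have ab0 : 0 < a + b by rewrite addr_gt0.
have t0 : 0 <= a / (a + b) by rewrite divr_ge0 ?ltW.
have t1 : a / (a + b) <= 1 by rewrite ler_pdivrMr // mul1r lerDl ltW.
pose t := Itv01 t0 t1.
have tE : 1 - a / (a + b) = b / (a + b) by field; rewrite gt_eqF.
have Q (u v : R) : a * u + b * v < 0 -> a / (a + b) * u + b / (a + b) * v < 0.
  have -> : a / (a + b) * u + b / (a + b) * v = (a * u + b * v) / (a + b).
    by field; rewrite gt_eqF.
  by rewrite pmulr_llt0 ?invr_gt0.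
exists (y <| t |> z); first exact: cD.
split.
- apply: le_lt_trans (cg t y z yD zD) _; rewrite convR_subE /= tE; apply: Q.
  by rewrite /a /b; nra.
- apply: le_lt_trans (ch t y z yD zD) _; rewrite convR_subE /= tE; apply: Q.
  by rewrite /a /b; nra.
Qed.

Lemma convex_pair_alternative (R : realType) (E : lmodType R)
    (D : set (convex_lmodType E)) (g h : E -> R) :
  convex_set D -> convex_function D g -> convex_function D h ->
  (forall y, y \in D -> g y < 0 -> 0 <= h y) ->
  exists t : {i01 R}, forall y, y \in D -> 0 <= (g y : R^o) <| t |> h y.
Proof.
move=> cD cg ch gh.
have [[y0 y0D gy0]|gge] := pselect (exists2 y, y \in D & g y < 0); last first.
  exists 1%:i01 => y yD; rewrite conv1 leNgt; apply/negP => gy.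
  by apply: gge; exists y.
have [[z0 z0D hz0]|hge] := pselect (exists2 y, y \in D & h y < 0); last first.
  exists 0%:i01 => y yD; rewrite conv0 leNgt; apply/negP => hy.
  by apply: hge; exists y.
have hg y : y \in D -> h y < 0 -> 0 <= g y.
  by move=> yD hy; rewrite leNgt; apply/negP => /(gh _ yD); rewrite leNgt hy.
(* Let [t] be the weight of [g]. Where [h z < 0], the combination is nonnegative iff [t >= r z];
   where [g y < 0], iff [t <= h y / (h y - g y)]. The supremum of the lower bounds will serve as
   weight. *)
pose r z := - h z / (g z - h z).
pose S := [set r z | z in [set z | z \in D /\ h z < 0]].
have S0 : S !=set0 by exists (r z0), z0.
have Sub y : y \in D -> g y < 0 -> ubound S (h y / (h y - g y)).
  move=> yD gy _ [z [zD hz] <-]; rewrite leNgt; apply/negP => lt.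
  have hy := gh _ yD gy; have gz := hg _ zD hz.
  (* A lower bound exceeding an upper bound is, after clearing denominators, the overlap condition,
     which would make [g] and [h] negative at a common point. *)
  have [|w wD [gw hw]] :=
    @convex_lt0_segment _ _ _ g h y z cD cg ch yD zD gy hz hy gz.
    move: lt; rewrite /r ltr_pdivrMr; last by lra.
    rewrite mulrAC ltr_pdivlMr; last by lra.
    by nra.
  by have := gh _ wD gw; rewrite leNgt hw.
have uS : has_ubound S by exists (h y0 / (h y0 - g y0)); exact: Sub.
have Sle z : z \in D -> h z < 0 -> r z <= sup S.
  by move=> zD hz; apply: ub_le_sup => //; exists z.
have leS y : y \in D -> g y < 0 -> sup S <= h y / (h y - g y).
  by move=> yD gy; apply: ge_sup => //; exact: Sub.
have t0 : 0 <= sup S.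
  have gz0 := hg _ z0D hz0.
  by apply: le_trans (Sle _ z0D hz0); apply: divr_ge0; lra.
have t1 : sup S <= 1.
  have hy0 := gh _ y0D gy0.
  by apply: le_trans (leS _ y0D gy0) _; rewrite ler_pdivrMr; lra.
exists (Itv01 t0 t1) => y yD; rewrite convR_subE /=.
have [gy|gy] := ltP (g y) 0.
  have hy := gh _ yD gy; have := leS _ yD gy.
  by rewrite ler_pdivlMr; [nra|lra].
have [hy|hy] := ltP (h y) 0.
  have := Sle _ yD hy.
  by rewrite ler_pdivrMr; [nra|lra].
by apply: addr_ge0; apply: mulr_ge0 => //; lra.
Qed.

(** Ky Fan's concavelike condition, stated for the family of slices: no linear structure on the
    index set is needed, as combinations only have to be dominated within [H]. *)
Definition concavelike {R : realType} {T : Type} (Y : set T)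
    (H : set (T -> R)) :=
  forall h1 h2 (t : {i01 R}), H h1 -> H h2 ->
    exists2 h, H h & forall y, y \in Y -> (h1 y : R^o) <| t |> h2 y <= h y.

(** The induction on [s] varies both [K] and [h]: the head of [s] takes the place of [h], and [K]
    shrinks to its part where [h] is negative. *)
Lemma finite_alternative (R : realType) (E : lmodType R)
    (Y K : set (convex_lmodType E)) (H : set (E -> R)) (h : E -> R)
    (s : seq (E -> R)) :
  concavelike Y H -> (forall g, H g -> convex_function Y g) ->
  K `<=` Y -> convex_set K -> H h -> {in s, forall g, H g} ->
  (exists2 y, y \in K & h y < 0 /\ {in s, forall g, g y < 0}) \/
  (exists2 g, H g & forall y, y \in K -> 0 <= g y).
Proof.
move=> cH cvxH; elim: s h K => [|g s IH] h K KY cK Hh Hs.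
  have [[y yK hy]|hge] := pselect (exists2 y, y \in K & h y < 0).
    by left; exists y.
  right; exists h => // y yK; rewrite leNgt; apply/negP => hy.
  by apply: hge; exists y.
have KYP y : y \in K -> y \in Y by rewrite !inE; exact: KY.
have cvxK g' : H g' -> convex_function K g'.
  by move=> Hg' t y z yK zK; apply: cvxH => //; exact: KYP.
pose L : set (convex_lmodType E) := [set y | y \in K /\ h y < 0].
have LK y : y \in L -> y \in K /\ h y < 0 by rewrite inE.
have cL : convex_set L.
  move=> y z t /LK[yK hy] /LK[zK hz]; rewrite inE; split; first exact: cK.
  apply: le_lt_trans (cvxK _ Hh t y z yK zK) _; rewrite convR_subE.
  (* Strictness is taken from the term in [h y], which vanishes when the weight is 0. *)
  have [t0|t0] := eqVneq t%:num 0.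
    by rewrite t0 mul0r add0r subr0 mul1r.
  rewrite -[ltRHS]addr0; apply: ltr_leD.
    by rewrite pmulr_rlt0 // lt_neqAle eq_sym t0 ge0.
  by apply: mulr_ge0_le0; [rewrite subr_ge0 le1|exact: ltW].
have LY : L `<=` Y by move=> y [yK _]; apply: KY; rewrite inE in yK.
have [||[y yL [gy sy]]|[g' Hg' g'L]] := IH g L LY cL.
- by apply: Hs; rewrite mem_head.
- by move=> g' g's; apply: Hs; rewrite inE g's orbT.
- have [yK hy] := LK _ yL; left; exists y => //; split => // g'.
  by rewrite inE => /predU1P[->|/sy].
(* Here [g'] is nonnegative wherever [h] is negative on [K], so some combination of the two is
   nonnegative on [K], and a member of [H] dominates it. *)
- right.
  have [|t tP] :=
    @convex_pair_alternative _ _ K h g' cK (cvxK _ Hh) (cvxK _ Hg').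
    by move=> y yK hy; apply: g'L; rewrite inE.
  have [k Hk kP] := cH h g' t Hh Hg'.
  by exists k => // y yK; apply: le_trans (tP y yK) (kP _ (KYP _ yK)).
Qed.

(** Finite intersection property for the sets [A h], whose weak inequality makes them closed.
    Finitely many of them meet by [finite_alternative]: its second branch is excluded because each
    member of [H] is negative somewhere on [Y]. *)
Lemma compact_alternative (R : realType) (E : normedModType R)
    (Y : set E) (H : set (E -> R)) :
  Y !=set0 -> compact Y -> convex_set (Y : set (convex_lmodType E)) ->
  concavelike Y H ->
  (forall h, H h -> convex_function (Y : set (convex_lmodType E)) h) ->
  (forall h, H h -> {within Y, continuous h}) ->
  (forall h, H h -> exists2 y, y \in Y & h y < 0) ->
  exists2 y, y \in Y & forall h, H h -> h y <= 0.
Proof.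
move=> [y0 Yy0] cptY cY cH cvxH ctsH negH.
have clY : closed Y by apply: compact_closed => //; exact: norm_hausdorff.
pose A (h : E -> R) : set E := Y `&` [set y | h y <= 0].
have [[h0 Hh0]|H0] := pselect (H !=set0); last first.
  by exists y0; [rewrite inE|move=> h Hh; case: H0; exists h].
have [y yA] : \bigcap_(h in H) A h !=set0.
  move: (cptY); rewrite compact_In0; apply.
    exists A => h Hh; last by rewrite /A setIA setIid.
    rewrite /A setIC closed_setIS //.
    by move/continuous_closedP : (ctsH h Hh) => /(_ _ (@closed_le _ 0)).
  move=> s sH.
  have [] :=
    @finite_alternative _ _ Y Y H h0 (finmap.enum_fset s) cH cvxH _ cY Hh0.
  - by [].
  - by move=> g gs; have := sH g gs; rewrite inE.
  - move=> [y yY [_ sy]]; exists y => g /= gs; split; first by rewrite inE in yY.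
    exact/ltW/sy.
  - by move=> [g /negH[y yY gy]] /(_ _ yY); rewrite leNgt gy.
exists y; last by move=> h /yA[].
by rewrite inE; have [] := yA h0 Hh0.
Qed.

Lemma within_continuous_slice (S T U : topologicalType) (A : set S)
    (B : set T) (f : T -> U) (g : S -> T) :
  {within B, continuous f} -> continuous g -> (forall x, A x -> B (g x)) ->
  {within A, continuous (fun x => f (g x))}.
Proof.
move=> cf cg AB; apply/subspace_continuousP => x Ax.
have /subspace_continuousP/(_ _ (AB _ Ax)) fgx := cf.
apply: (cvg_comp g f _ fgx) => P /cg gP.
have {}gP : \forall x' \near x, B (g x') -> P (g x') by exact: gP.
suff : \forall x' \near x, A x' -> P (g x') by [].
by apply: filterS gP => x' /= + Ax'; apply; exact: AB.
Qed.

Theorem theorem3p1 (R : realType) (d k : nat)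
    (X : set 'rV[R]_d) (Y : set 'rV[R]_k)
    (f : 'rV[R]_d * 'rV[R]_k -> R)
    (convexX : convex_set X) (compactX : compact X)
    (intX : interior X !=set0)
    (convexY : convex_set Y) (compactY : compact Y)
    (intY : interior Y !=set0)
    (contf : {within X `*` Y, continuous f})
    (concavef : forall y, y \in Y -> concave_function X (fun x => f (x, y)))
    (convexf : forall x, x \in X -> convex_function Y (fun y => f (x, y))) :
  exists p : 'rV[R]_d * 'rV[R]_k, saddle_point X Y f p.
Proof.
have X0 : X !=set0 by have [x /interior_subset Xx] := intX; exists x.
have Y0 : Y !=set0 by have [y /interior_subset Yy] := intY; exists y.
have contX y : y \in Y -> {within X, continuous (fun x => f (x, y))}.
  rewrite inE => Yy; apply: (within_continuous_slice _ _ _ _ _ _ _ contf) => //.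
  by move=> x; exact: (cvg_pair (@cvg_id _ (nbhs x)) (cvg_cst y)).
have contY x : x \in X -> {within Y, continuous (fun y => f (x, y))}.
  rewrite inE => Xx; apply: (within_continuous_slice _ _ _ _ _ _ _ contf) => //.
  by move=> y; exact: (cvg_pair (cvg_cst x) (@cvg_id _ (nbhs y))).
pose W := [set b | exists2 x, x \in X & forall y, y \in Y -> b <= f (x, y)].
pose v := sup W.
have W0 : W !=set0.
  have [x Xx] := X0; have xX : x \in X by rewrite inE.
  have [y yY yP] := compact_EVT_min Y0 compactY (contY _ xX).
  by exists (f (x, y)), x.
have uW : has_ubound W.
  have [y Yy] := Y0; have yY : y \in Y by rewrite inE.
  have [x xX xP] := compact_EVT_max X0 compactX (contX _ yY).
  by exists (f (x, y)) => b [x' x'X /(_ _ yY)/le_trans]; apply; exact: xP.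
(* The strict shift [v < a] makes each member negative somewhere; letting [a] vary with [x] keeps
   the family concavelike. *)
pose HY : set ('rV[R]_k -> R) :=
  [set h | exists x a, [/\ x \in X, v < a & h = fun y => f (x, y) - a]].
pose HX : set ('rV[R]_d -> R) :=
  [set h | exists y b, [/\ y \in Y, b < v & h = fun x => b - f (x, y)]].
have convex_lt (a b c : R) (t : {i01 R}) : a < b -> a < c ->
  a < (b : R^o) <| t |> c.
  rewrite -![_ < c]subr_gt0 -![_ < b]subr_gt0 => ab ac.
  by have := convR_gt0 t ab ac; rewrite !convR_subE; lra.
have [ys ysY ysP] : exists2 y, y \in Y & forall h, HY h -> h y <= 0.
  apply: compact_alternative => //.
  - move=> _ _ t [x1 [a1 [x1X a1v ->]]] [x2 [a2 [x2X a2v ->]]].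
    eexists; first by exists ((x1 : convex_lmodType 'rV[R]_d) <| t |> x2),
      ((a1 : R^o) <| t |> a2);
      split; [exact: convexX|exact: convex_lt|].
    move=> y yY /=.
    have := concavef _ yY t _ _ x1X x2X; rewrite !convR_subE /=; lra.
  - move=> _ [x [a [xX av ->]]] t y z yY zY.
    have := convexf _ xX t _ _ yY zY; rewrite !convR_subE /=; lra.
  - move=> _ [x [a [xX av ->]]] y.
    by apply: cvgB; [exact: contY|exact: cvg_cst].
  - move=> _ [x [a [xX av ->]]].
    (* If [f (x, y) >= a] held on all of [Y], then [a] would belong to [W], hence [a <= v]. *)
    apply: contrapT => H; move: av; rewrite ltNge => /negP; apply.
    apply: ub_le_sup => //; exists x => // y yY; rewrite -subr_ge0 leNgt.
    by apply/negP => lt; apply: H; exists y.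
have [xs xsX xsP] : exists2 x, x \in X & forall h, HX h -> h x <= 0.
  apply: compact_alternative => //.
  - move=> _ _ t [y1 [b1 [y1Y b1v ->]]] [y2 [b2 [y2Y b2v ->]]].
    eexists; first (exists ((y1 : convex_lmodType 'rV[R]_k) <| t |> y2),
      ((b1 : R^o) <| t |> b2);
      split; [exact: convexY| |by []]).
      by rewrite -ltrN2 convN; apply: convex_lt; rewrite ltrN2.
    move=> x xX /=.
    have := convexf _ xX t _ _ y1Y y2Y; rewrite !convR_subE /=; lra.
  - move=> _ [y [b [yY bv ->]]] t x z xX zX.
    have := concavef _ yY t _ _ xX zX; rewrite !convR_subE /=; lra.
  - move=> _ [y [b [yY bv ->]]] x.
    by apply: cvgB; [exact: cvg_cst|exact: contX].
  - move=> _ [y [b [yY bv ->]]].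
    (* Some [c] in [W] exceeds [b]; its witness [x] does not depend on [y]. *)
    have [c [x xX xP] bc] := sup_gt W0 bv.
    by exists x => //; rewrite subr_lt0 (lt_le_trans bc) ?xP.
(* The strict shifts are removed by taking [a = v + e] here, and [b = v - e] below, for arbitrary
   [e > 0]. *)
have fys x : x \in X -> f (x, ys) <= v.
  move=> xX; apply/ler_addgt0Pr => e e0.
  by rewrite -subr_le0; apply: (ysP (fun y => f (x, y) - (v + e)));
    exists x, (v + e); rewrite ltrDl.
have fxs y : y \in Y -> v <= f (xs, y).
  move=> yY; apply/ler_addgt0Pr => e e0.
  by rewrite -lerBlDr -subr_le0; apply: (xsP (fun x => v - e - f (x, y)));
    exists y, (v - e); rewrite gtrBl.
have vE : f (xs, ys) = v by apply/eqP; rewrite eq_le fys ?fxs.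
exists (xs, ys); split; first by rewrite inE; split; apply/set_mem.
by move=> x y xX yY; rewrite /= vE fys ?fxs.
Qed.
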